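(* $\lim_{k\to\infty}\frac{f(k)}{k}=\frac{1}{4}$.
   Context: Let $P\subset\mathbb{Z}^2$ be a finite set of grid points. There are four directions: horizontal $(1,0)$, vertical $(0,1)$, and the two diagonals $(1,1)$ and $(1,-1)$. For a direction $d$ and an integer $k\ge 1$, a line segment of length $k$ of $P$ in direction $d$ is a set $\{p,p+d,\dots,p+(k-1)d\}\subseteq P$ such that $p-d\notin P$ and $p+kd\notin P$ (a maximal run of exactly $k$ points). Segments are counted separately for each direction, so that an isolated point gives $4$ line segments of length $1$. For integers $k,n\ge 1$, $a_k(n)$ denotes the minimal cardinality of a finite set $P\subset\mathbb{Z}^2$ that has at least $n$ line segments of length $k$ (counted over all four directions). Define $f(k)=\lim_{n\to\infty}\frac{a_k(n)}{n}$; this limit exists for every integer $k\ge 1$. *)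

(* Defs.v *)
From mathcomp Require Import all_boot all_order all_algebra finmap.
From mathcomp Require Import all_classical all_reals all_analysis.

From mathcomp Require Import zify.

Set Implicit Arguments.
Unset Strict Implicit.
Unset Printing Implicit Defensive.

Import Order.TTheory GRing.Theory Num.Theory.
Import numFieldNormedType.Exports.
Local Open Scope classical_set_scope.
Local Open Scope ring_scope.

Notation point := (int * int)%type.

Definition directions : seq point := [:: (1, 0); (0, 1); (1, 1); (1, -1)].

Definition run (d : point) (k : nat) (p : point) : {fset point} :=
  [fset (p + d *+ i)%R | i in iota 0 k]%fset.

(* The condition [p \in P] is implied by [run d k p `<=` P] when [0 < k]; it
   only serves to make the comprehension range over a finite set. *)
Definition segments (d : point) (k : nat) (P : {fset point}) :
    {fset {fset point}} :=
  [fset run d k p | p in P &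
    [&& run d k p `<=` P, (p - d)%R \notin P & (p + d *+ k)%R \notin P]]%fset.

Definition num_segments (k : nat) (P : {fset point}) : nat :=
  (\sum_(d <- directions) #|` segments d k P|)%N.

Definition realizable (k n m : nat) : Prop :=
  exists2 P : {fset point}, #|` P| = m & (n <= num_segments k P)%N.

(* The minimum exists as soon as [0 < k], see [aP] below; the default
   value 0 is used only for [k = 0]. *)
Definition a (k n : nat) : nat :=
  xget 0%N [set m | realizable k n m /\
                    forall m', realizable k n m' -> (m <= m')%N].

Lemma realizable_ex (k n : nat) : (0 < k)%N -> exists m, realizable k n m.
Proof.
move=> k_gt0; pose c i j : point := ((i * k.+1 + j)%N%:Z, 0).
pose P : {fset point} := [fset c i j | i in iota 0 n, j in iota 0 k]%fset.
exists #|` P|, P => //.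
have inP x y : (x, y) \in P -> exists i j, [/\ (i < n)%N, (j < k)%N &
    x = (i * k.+1 + j)%N%:Z].
  by case/imfset2P => i /= + [j /= + [-> _]]; rewrite !mem_iota => ? ?; exists i, j.
have cE i j : c i 0%N + (1, 0) *+ j = c i j.
  rewrite /c addn0; elim: j => [|j IH]; first by rewrite mulr0n addr0 addn0.
  by rewrite mulrSr addrA IH addnS intS addrC.
have c_inj i j : run (1, 0) k (c i 0%N) = run (1, 0) k (c j 0%N) -> i = j.
  move=> E; have: c i 0%N \in run (1, 0) k (c i 0%N).
    by apply/imfsetP; exists 0%N; rewrite /= ?mem_iota ?mulr0n ?addr0.
  rewrite E => /imfsetP [l /=]; rewrite mem_iota cE => /andP[_ lk] [].
  rewrite addn0 => /(congr1 (fun m => m %/ k.+1)%N).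
  by rewrite mulnK // divnMDl // divn_small ?addn0 // ltnW // ltnS ltnW.
rewrite /num_segments /directions big_cons.
apply: leq_trans (leq_addr _ _).
pose S := [fset run (1, 0) k (c i 0%N) | i in iota 0 n]%fset.
have <- : #|` S| = n.
  rewrite card_in_imfset /=; last by move=> i j _ _; apply: c_inj.
  by rewrite undup_id ?iota_uniq ?size_iota.
apply/fsubset_leq_card/fsubsetP => _ /imfsetP [i /= + ->].
rewrite mem_iota /= add0n => i_n; apply/imfsetP; exists (c i 0%N) => //=.
rewrite inE /=; apply/andP; split.
  by apply/imfset2P; exists i; rewrite ?mem_iota //; exists 0%N; rewrite ?mem_iota.
apply/and3P; split.
- apply/fsubsetP => _ /imfsetP [j /= + ->]; rewrite cE => jk.
  by apply/imfset2P; exists i; rewrite ?mem_iota //; exists j.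
- apply/negP => /inP [i' [j [_ jk /eqP]]].
  rewrite /c addn0 subr_eq -PoszD eqz_nat addn1 -addnS.
  move/eqP/(congr1 (modn^~ k.+1)); rewrite modnMl modnMDl modn_small //; lia.
- rewrite cE; apply/negP => /inP [i' [j [_ jk [E]]]].
  by move/(congr1 (modn^~ k.+1)): E; rewrite !modnMDl !modn_small//; lia.
Qed.

Lemma aP (k n : nat) : (0 < k)%N ->
  realizable k n (a k n) /\ (forall m, realizable k n m -> (a k n <= m)%N).
Proof.
move=> k_gt0; rewrite /a; case: xgetP => [m _ []//|].
have [m0 m0P] := realizable_ex n k_gt0.
have ex : exists m, `[< realizable k n m >] by exists m0; apply/asboolP.
case: (ex_minnP ex) => m /asboolP mP mmin /(_ m) [].
by split=> // m' m'P; apply/mmin/asboolP.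
Qed.

(* [lim] is a choice operator with an arbitrary value on divergent sequences;
   here [a k] is subadditive in [n] when [0 < k], so the limit exists. *)
Definition f (R : realType) (k : nat) : R :=
  lim ((fun n : nat => (a k n)%:R / n%:R : R) @ \oo).

(* Main.v *)
(** For a fixed direction the runs of length [k] are pairwise disjoint, so [k]
    times the number of segments is at most [4 #|P|] and [f k >= k / 4].

    For the upper bound let [m = k + 1] and take a large square minus an
    [m]-periodic set of holes which meets every line (in the four directions)
    of the torus [(Z/m)^2] at most once: consecutive holes on a line are then
    exactly [m] apart, and separated by a run of [k] points. Such a hole set is
    a partial solution of the toroidal queens problem. When [m] is prime to 6
    the queens [(x, 2x)] give a full solution; in general [y = 2x + c(x)] with a
    suitable bounded step function [c] gives a solution with at least [m - 20]
    queens, so that [f k <= (m + 4)^2 / (4 (m - 20))]. The limit defining [f k]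
    is the infimum by Fekete's lemma, because far apart translates of two
    configurations add up. *)
Require Import Defs.
From mathcomp Require Import all_boot all_order all_algebra finmap.
From mathcomp Require Import all_classical all_reals all_analysis.
From mathcomp Require Import zify ring lra.

Set Implicit Arguments.
Unset Strict Implicit.
Unset Printing Implicit Defensive.

Import Order.TTheory GRing.Theory Num.Theory.
Import numFieldNormedType.Exports.
Local Open Scope classical_set_scope.
Local Open Scope ring_scope.

(* [all_analysis] has its own [point], which hides the notation of [Defs]. *)
Local Notation point := (int * int)%type.

(** * Fekete's subadditive lemma *)

(** Choose [N] with [u N / N] close to the infimum and write [n = q N + r]: then [u n <= q u N + M],
    where [M] dominates every remainder term [u r], and [M / n] vanishes. *)
Lemma fekete (R : realType) (u : nat -> R) : (forall n, 0 <= u n) ->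
  (forall m n, u (m + n)%N <= u m + u n) ->
  u n / n%:R @[n --> \oo] --> inf [set u n / n%:R | n in [set n | (0 < n)%N]].
Proof.
move=> u_ge0 uD; set E := (X in inf X).
have lbE : lbound E 0 by move=> _ [n _ <-]; rewrite divr_ge0.
have hE : has_inf E by split; [exists (u 1%N / 1); exists 1%N|exists 0].
have uM q n r : u (q * n + r)%N <= q%:R * u n + u r.
  elim: q => [|q IH]; first by rewrite mul0r add0r.
  rewrite mulSn -addnA (le_trans (uD _ _)) // -natr1 mulrDl mul1r.
  by rewrite [_ + u n]addrC -addrA lerD2l.
apply/cvgrPdist_le => e e_gt0.
have e2 : 0 < e / 2 by rewrite divr_gt0.
have [_ [N /= N_gt0 <-] lN] := inf_adherent e2 hE.
pose M := \sum_(r < N) u r.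
near=> n; have n_gt0 : (0 < n)%N by near: n; exists 1%N.
have n0 : 0 < n%:R :> R by rewrite ltr0n.
have le_inf : inf E <= u n / n%:R by apply: ge_inf; [exists 0|exists n].
rewrite distrC ger0_norm ?subr_ge0 // lerBlDr addrC.
have Mn : M / n%:R <= e / 2.
  rewrite ler_pdivrMr // mulrC -ler_pdivrMr //.
  near: n; exact: nbhs_infty_ger.
suff : u n / n%:R <= u N / N%:R + M / n%:R by lra.
have N0 : 0 < N%:R :> R by rewrite ltr0n.
rewrite ler_pdivrMr // mulrDl divfK ?gt_eqF // {1}(divn_eq n N).
apply: le_trans (uM _ _ _) _; apply: lerD; last first.
  rewrite /M (bigD1 (Ordinal (ltn_pmod n N_gt0))) //= lerDl.
  exact: sumr_ge0.
rewrite mulrC -mulrA ler_wpM2l // mulrC ler_pdivlMr // -natrM ler_nat.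
exact: leq_trunc_div.
Unshelve. all: by end_near. Qed.

(** * Segments counted by their first points *)

Section Starts.
Variables (d : point) (k : nat).
Implicit Type P Q : {fset point}.

Definition starts P : {fset point} :=
  [fset p in P | [&& run d k p `<=` P, (p - d)%R \notin P & (p + d *+ k)%R \notin P]]%fset.

Lemma runP p q :
  reflect (exists2 i, (i < k)%N & q = p + d *+ i) (q \in run d k p).
Proof.
apply: (iffP (imfsetP _ _ _ _)) => /= -[i ik ->]; exists i => //;
  by move: ik; rewrite /= mem_iota.
Qed.

Lemma startsP P p : (0 < k)%N ->
  reflect [/\ forall i, (i < k)%N -> p + d *+ i \in P,
    p - d \notin P & p + d *+ k \notin P] (p \in starts P).
Proof.
move=> k_gt0; rewrite !inE /=; apply: (iffP andP) => [[_ /and3P[]]|].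
  move=> /fsubsetP rP pd pk; split=> // i ik; apply: rP; apply/runP.
  by exists i.
move=> [rP -> ->]; rewrite !andbT; split.
  by rewrite -[p]addr0 -(mulr0n d) rP.
by apply/fsubsetP => _ /runP[i ik ->]; apply: rP.
Qed.

Lemma starts_run_inj P p q i j : p \in starts P -> q \in starts P ->
  (i < k)%N -> (j < k)%N -> p + d *+ i = q + d *+ j -> p = q.
Proof.
wlog ij : p q i j / (i <= j)%N => [W|] pS qS ik jk E.
  by have [ij|/ltnW ij] := leqP i j; [apply: W E|apply/esym; apply: W (esym E)].
have k_gt0 : (0 < k)%N by apply: leq_ltn_trans ik.
have [_ pd _] := startsP P p k_gt0 pS; have [qP _ _] := startsP P q k_gt0 qS.
have {E} : p = q + d *+ (j - i).
  by apply: (addIr (d *+ i)); rewrite E -addrA -mulrnDr subnK.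
case: (j - i)%N (leq_subr i j) => [_|t tj E]; first by rewrite mulr0n addr0.
by case/negP: pd; rewrite E mulrSr addrA addrK qP // ltnW // (leq_ltn_trans tj).
Qed.

Lemma card_segments P : (0 < k)%N -> #|` segments d k P| = #|` starts P|.
Proof.
move=> k_gt0; have -> : segments d k P = [fset run d k p | p in starts P]%fset.
  apply/fsetP => r; apply/imfsetP/imfsetP => /= -[p pS ->]; exists p => //.
    by rewrite !inE.
  by move: pS; rewrite !inE.
rewrite card_in_imfset //= => p q pS qS E.
have /runP[i ik E'] : p \in run d k q.
  by rewrite -E; apply/runP; exists 0%N; rewrite ?mulr0n ?addr0.
by apply: starts_run_inj pS qS k_gt0 ik _; rewrite mulr0n addr0.
Qed.

Lemma card_starts P : d != 0 -> (k * #|` starts P| <= #|` P|)%N.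
Proof.
move=> d0; case: (posnP k) => [->//|k_gt0].
pose g (u : point * nat) := u.1 + d *+ u.2.
pose S : seq (point * nat) := [seq (p, i) | p <- starts P, i <- iota 0 k].
have SP u : u \in S -> u.1 \in starts P /\ (u.2 < k)%N.
  by case/allpairsP => -[p i] /= [pS]; rewrite mem_iota => ik ->.
have -> : (k * #|` starts P| = size (map g S))%N.
  by rewrite size_map size_allpairs size_iota mulnC cardfE.
apply: uniq_leq_size.
  rewrite map_inj_in_uniq ?allpairs_uniq ?fset_uniq ?iota_uniq//.
    by move=> [? ?] [? ?] _ _ [-> ->].
  move=> [p i] [q j] /SP/= [pS ik] /SP/= [qS jk] E.
  have pq := starts_run_inj pS qS ik jk E; congr pair => //.
  move: E; rewrite /g /= pq => /addrI; move: d0; case: (d) => d1 d2.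
  rewrite !pairMnE xpair_eqE negb_and => /orP[] n0 [e1 e2].
    by apply: (mulrIn n0 e1).
  by apply: (mulrIn n0 e2).
by move=> _ /mapP[u /SP[uS uk] ->]; have [rP _ _] := startsP P u.1 k_gt0 uS; apply: rP.
Qed.

(** The two points bounding a run of [P] are [d]-neighbours of its end points, so the run stays
    maximal if [Q] avoids all [d]-neighbours of [P]. *)
Lemma starts_fsetU P Q :  (0 < k)%N ->
  (forall p, p \in P -> p - d \notin Q /\ p + d \notin Q) ->
  (starts P `<=` starts (P `|` Q))%fset.
Proof.
move=> k_gt0 PQ; apply/fsubsetP => p pS; have [rP pd pk] := startsP P p k_gt0 pS.
apply/startsP => //; split=> [i ik||]; rewrite in_fsetU; first by rewrite rP.
  rewrite negb_or pd; have [] // := PQ p.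
  by rewrite -[p]addr0 -(mulr0n d) rP.
rewrite negb_or pk -(prednK k_gt0) mulrSr addrA.
by have [] // := PQ (p + d *+ k.-1); rewrite rP ?prednK.
Qed.

Lemma card_starts_shift P (v : point) : (0 < k)%N ->
  (#|` starts P| <= #|` starts [fset (p + v)%R | p in P]%fset|)%N.
Proof.
move=> k_gt0; have <- : #|` [fset (p + v)%R | p in starts P]%fset| = #|` starts P|.
  by rewrite card_imfset //=; apply: addIr.
have sE q : (q + v \in [fset (p + v)%R | p in P]%fset) = (q \in P).
  by apply/imfsetP/idP => /= [[? ? /addIr ->]//|qP]; exists q.
apply/fsubset_leq_card/fsubsetP => _ /imfsetP[p /= pS ->].
have [rP pd pk] := startsP P p k_gt0 pS.
by apply/startsP => //; split=> [i ik||]; rewrite addrAC sE //; apply: rP.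
Qed.

End Starts.

(** * Linear lower bound and subadditivity of [a k] *)

Lemma num_segmentsE k P : (0 < k)%N ->
  num_segments k P = (\sum_(d <- directions) #|` starts d k P|)%N.
Proof. by move=> k_gt0; apply: eq_bigr => d _; apply: card_segments. Qed.

Lemma realizable_ge k n m : (0 < k)%N -> realizable k n m -> (k * n <= 4 * m)%N.
Proof.
move=> k_gt0 [P <- nP]; apply: leq_trans (leq_mul (leqnn k) nP) _.
rewrite num_segmentsE // big_distrr /=.
have -> : (4 * #|` P| = \sum_(d <- directions) #|` P|)%N.
  by rewrite big_const_seq iter_addn_0 mulnC.
rewrite !big_seq; apply: leq_sum => d dD; apply: card_starts.
by move: d dD; apply/allP.
Qed.

Lemma fset_bounded (P : {fset point}) :
  exists B : nat, forall p : point, p \in P -> (`|p.1| <= B)%N.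
Proof.
exists (\max_(p <- P) `|p.1|)%N => p pP.
exact: (@leq_bigmax_seq _ _ xpredT (fun p : point => `|p.1|%N)).
Qed.

Lemma realizableD k n1 n2 m1 m2 : (0 < k)%N ->
  realizable k n1 m1 -> realizable k n2 m2 -> realizable k (n1 + n2) (m1 + m2).
Proof.
move=> k_gt0 [P <- nP] [Q <- nQ].
have [[BP BPP] [BQ BQQ]] := (fset_bounded P, fset_bounded Q).
(* This shift puts [Q] at least 2 columns to the right of [P], while a direction changes the column
   by at most 1. *)
pose v : point := ((BP + BQ + 2)%N%:Z, 0).
pose Q' := [fset (p + v)%R | p in Q]%fset.
have sep (p q : point) : p \in P -> q \in Q' -> p.1 + 2 <= q.1.
  move=> /BPP p1 /imfsetP[q' /= /BQQ q1 ->] /=.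
  by move: p.1 q'.1 p1 q1 => x y; lia.
have PQ0 : [disjoint P & Q']%fset.
  apply/fdisjointP => p pP; apply/negP => pQ; have := sep p p pP pQ; lia.
exists (P `|` Q')%fset.
  by rewrite cardfsU (disjoint_fsetI0 PQ0) cardfs0 subn0 card_imfset //; apply: addIr.
apply: leq_trans (leq_add nP nQ) _; rewrite !num_segmentsE // -big_split /=.
rewrite !big_seq; apply: leq_sum => d dD.
have d1 : `|d.1| <= 1 by move: d dD; apply/allP.
apply: leq_trans (leq_add (leqnn _) (card_starts_shift _ _ v k_gt0)) _.
have S0 : (starts d k P `&` starts d k Q' = fset0)%fset.
  apply: disjoint_fsetI0; apply/fdisjointP => p; rewrite !inE => /andP[pP _].
  by rewrite (negPf (fdisjointP PQ0 p pP)).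
have -> : (#|` starts d k P| + #|` starts d k Q'| =
    #|` (starts d k P `|` starts d k Q')%fset|)%N.
  by rewrite cardfsU S0 cardfs0 subn0.
apply: fsubset_leq_card; rewrite fsubUset; apply/andP; split.
  apply: starts_fsetU => // p pP; split; apply/negP => /(sep _ _ pP) /=;
    by move: p.1 d.1 d1 => x y; lia.
rewrite fsetUC; apply: starts_fsetU => // p pQ.
by split; apply/negP => /sep /(_ pQ) /=; move: p.1 d.1 d1 => x y; lia.
Qed.

Lemma aD k n1 n2 : (0 < k)%N -> (a k (n1 + n2) <= a k n1 + a k n2)%N.
Proof.
move=> k_gt0; have [_] := aP (n1 + n2) k_gt0; apply; apply: realizableD => //.
  exact: (aP n1 k_gt0).1.
exact: (aP n2 k_gt0).1.
Qed.

(** * Partial solutions of the toroidal queens problem *)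

Section Queens.
Local Open Scope nat_scope.
Variable m : nat.

(* Two queens with [x < y] on the same line satisfy
   [s (y - x) + c(y) - c(x) = t m] where [s = 1, 2, 3] for the directions
   [(1, 1)], [(1, 0)], [(1, -1)] and [0 < t < s], so [y - x] is close to
   [m / 2], [m / 3] or [2 m / 3]. The jumps of [c] at [m / 3], [m / 2] and
   [2 m / 3] exclude this modulo [s]: [third_jump] is even and not congruent to
   [m] mod 3, [half_jump] is divisible by 3 and not congruent to [m] mod 2. *)
Let third_jump := if m %% 3 == 2 then 0 else 2.
Let half_jump := if odd m then 0 else 3.

Definition queen_shift (x : nat) : nat :=
  third_jump * ((m <= 3 * x) + (m.*2 <= 3 * x)) + half_jump * (m <= 2 * x).

(* The columns just before a jump of [c] are left without a queen. *)
Definition queen_col (x : nat) : bool :=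
  [&& x + 7 < m, ~~ (m <= 3 * x + 7 < m + 7), ~~ (m.*2 <= 3 * x + 7 < m.*2 + 7)
    & ~~ (m <= 2 * x + 7 < m + 7)].

Lemma queen_shift_le (x y : nat) : x <= y -> queen_shift x <= queen_shift y.
Proof.
move=> xy; rewrite /queen_shift; apply: leq_add; apply: leq_mul => //; lia.
Qed.

Lemma queen_shift_le7 (x : nat) : queen_shift x <= 7.
Proof. by rewrite /queen_shift /third_jump /half_jump; do 2 case: ifP => _; lia. Qed.

Lemma queen_inj (s x y : nat) : 0 < s < 4 -> queen_col x -> queen_col y ->
  s * x + queen_shift x = s * y + queen_shift y %[mod m] -> x = y.
Proof.
move=> s4; wlog xy : x y / x < y => [W Dx Dy E|].
  have [xy|xy|//] := ltngtP x y; first exact: W.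
  by apply/esym/W.
move=> Dx Dy /esym/eqP; have cxy := queen_shift_le (ltnW xy).
rewrite eqn_mod_dvd; last by nia.
case/dvdnP => t E; exfalso.
(* From [y + 7 < m] and [c <= 7], the sum [s (y - x) + c(y) - c(x)] stays below [s m]. *)
have t_lt : t < s.
  have /andP[ym _] := Dy; rewrite -(@ltn_pmul2r m); last by lia.
  rewrite -E; have := queen_shift_le7 y; move: {Dx Dy cxy E} ym; nia.
have t_gt0 : 0 < t by case: t E {t_lt} => //; nia.
have m3 : 3 * (m %/ 3) + m %% 3 = m by lia.
have m2 : odd m + 2 * m./2 = m by lia.
have {}E : s * y + queen_shift y = s * x + queen_shift x + t * m by nia.
move: Dx Dy E {cxy}.
rewrite /queen_col /queen_shift /third_jump /half_jump.
(* The excluded columns ensure that exactly [t] of the thresholds at multiples of [m / s] separate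
   [x] from [y]; the jumps there contradict the equation modulo [s]. *)
have [[-> ->]|[[-> ->]|[-> ->]]] : (s = 2 /\ t = 1) \/ (s = 3 /\ t = 1) \/ (s = 3 /\ t = 2) by lia.
- case: (odd m) m2 => m2; case: eqP => _; lia.
- case: eqP => m3'; case: ifP => _; lia.
- case: eqP => m3'; case: ifP => _; lia.
Qed.

Lemma queen_cols_size : m - 20 <= size [seq x <- iota 0 m | queen_col x].
Proof.
(* Windows covering all excluded columns, of total size 4 + 4 + 5 + 7 = 20. *)
pose E := iota (m %/ 3 - 3) 4 ++ iota (m.*2 %/ 3 - 3) 4 ++ iota (m./2 - 4) 5 ++
  iota (m - 7) 7.
rewrite leq_subLR -[20]/(size E) -size_cat -[leqLHS](size_iota 0).
apply: uniq_leq_size (iota_uniq _ _) _ => x.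
rewrite !mem_cat mem_filter !mem_iota /queen_col; lia.
Qed.

End Queens.

(** * The periodic set of holes *)

Definition queen (m x : nat) (i j : int) : point :=
  (x%:Z + m%:Z * i, (2 * x + queen_shift m x)%N%:Z + m%:Z * j).

Definition hole (m : nat) (p : point) : bool :=
  `[< exists x i j, queen_col m x /\ p = queen m x i j >].

Lemma queen_injz (m s x y : nat) (z : int) : (0 < s < 4)%N ->
  queen_col m x -> queen_col m y ->
  (s * x + queen_shift m x)%N%:Z = (s * y + queen_shift m y)%N%:Z + m%:Z * z ->
  x = y.
Proof.
move=> s4; wlog z_ge0 : x y z / 0 <= z => [W Dx Dy E|Dx Dy].
  case: (lerP 0 z) => z0; first exact: W E.
  by apply/esym; apply: (W y x (- z)) => //; lia.
case: z z_ge0 => // z _ E; apply: (@queen_inj m s) => //.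
have -> : (s * x + queen_shift m x = z * m + (s * y + queen_shift m y))%N by lia.
by rewrite modnMDl.
Qed.

Lemma queen_col_lt m x : queen_col m x -> (x + 7 < m)%N.
Proof. by case/andP. Qed.

Lemma dvdz_lt_eq (m : nat) (x y i j : int) : 0 <= x < m%:Z -> 0 <= y < m%:Z ->
  x + m%:Z * i = y + m%:Z * j -> i = j.
Proof.
move=> xm ym E; have : m%:Z * (i - j) = y - x by lia.
by case: (ltrgtP i j) => // ij; nia.
Qed.

Lemma point_mulrn (x y : int) n : (x, y) *+ n = (n%:Z * x, n%:Z * y) :> point.
Proof. by rewrite pairMnE -(mulr_natl x) -(mulr_natl y) natz. Qed.

Lemma queenD m x i j d : queen m x i j + d *+ m = queen m x (i + d.1) (j + d.2).
Proof.
case: d => d1 d2; rewrite point_mulrn /queen.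
by congr pair; rewrite /=; ring.
Qed.

(** Eliminating [t] from the two coordinates gives the queen equation with [s] = 2, 1, 3 for (1, 0),
    (1, 1), (1, -1); vertically the columns agree at once. Equal columns make [t] a multiple of
    [m]. *)
Lemma hole_spaced m p (d : point) t : d \in directions -> hole m p ->
  (0 < t < m)%N -> ~~ hole m (p + d *+ t).
Proof.
move=> dD /asboolP[x [i [j [Dx ->]]]] tm; apply/asboolPn => -[y [i' [j' [Dy]]]].
have [xm ym] := (queen_col_lt Dx, queen_col_lt Dy).
have inj s z := @queen_injz m s x y z ^~ Dx ^~ Dy.
have nt z : t%:Z = m%:Z * z -> False.
  have [z0|z0] : z <= 0 \/ 1 <= z by lia.
    by have := mulr_ge0_le0 (isT : 0 <= m%:Z) z0; lia.
  by have := ler_wpM2l (isT : 0 <= m%:Z) z0; lia.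
move: dD; rewrite !inE => /or4P[] /eqP ->; rewrite /queen point_mulrn;
  move=> [E1 E2].
- have xy : x = y by apply: (inj 2%N (j' - j)) => //; lia.
  by apply: (nt (i' - i)); rewrite xy in E1; lia.
- have ii : i = i' by apply: (@dvdz_lt_eq m x y) => //; lia.
  have xy : x = y by rewrite ii in E1; lia.
  by apply: (nt (j' - j)); rewrite xy in E2; lia.
- have xy : x = y by apply: (inj 1%N (j' - j - i' + i)) => //; lia.
  by apply: (nt (i' - i)); rewrite xy in E1; lia.
- have xy : x = y by apply: (inj 3%N (j' - j + i' - i)) => //; lia.
  by apply: (nt (i' - i)); rewrite xy in E1; lia.
Qed.

(** * The punctured square and its runs *)

Definition board (m : nat) : {fset point} :=
  [fset p in [fset (x%:Z, y%:Z) | x in iota 0 ((m + 4) * m), y in iota 0 ((m + 4) * m)]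
  | ~~ hole m p]%fset.

Lemma boardP m (p : point) : reflect
  [/\ 0 <= p.1 < ((m + 4) * m)%N%:Z, 0 <= p.2 < ((m + 4) * m)%N%:Z & ~~ hole m p]
  (p \in board m).
Proof.
rewrite !inE /=; apply: (iffP andP) => [[/imfset2P[x /= + [y /= + ->]] ->]|].
  by rewrite !mem_iota => xm ym; split=> //; lia.
case: p => [x y] /= [xm ym ->]; split=> //; apply/imfset2P => /=.
by exists `|x|%N; rewrite ?mem_iota; [|exists `|y|%N; rewrite ?mem_iota; [|congr pair]]; lia.
Qed.

Lemma card_board m : (#|` board m| <= ((m + 4) * m) ^ 2)%N.
Proof.
set N := ((m + 4) * m)%N.
pose S : seq point := [seq (x%:Z, y%:Z) | x <- iota 0 N, y <- iota 0 N].
have <- : size S = (N ^ 2)%N by rewrite size_allpairs size_iota mulnn.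
apply: uniq_leq_size => // -[x y] /boardP[/= xN yN _].
by apply/allpairsP; exists (`|x|%N, `|y|%N); rewrite /= !mem_iota; split; [| |congr pair]; lia.
Qed.

(** The run lies between two holes [m] steps apart. Since [j >= 1], runs along (1, -1) stay
    nonnegative; since [2 x + c(x) < 2 m], the four extra periods contain the overflow above. *)
Lemma board_starts m x (i j : nat) d : d \in directions -> queen_col m x ->
  (0 < i <= m)%N -> (0 < j <= m)%N -> queen m x i j + d \in starts d m.-1 (board m).
Proof.
move=> dD Dx im jm; have xm := queen_col_lt Dx.
have c7 := queen_shift_le7 m x.
have h0 : hole m (queen m x i j) by apply/asboolP; exists x, i, j.
have hm : hole m (queen m x i j + d *+ m).
  by apply/asboolP; rewrite queenD; exists x, (i%:Z + d.1), (j%:Z + d.2).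
have dS t : queen m x i j + d + d *+ t = queen m x i j + d *+ t.+1.
  by rewrite mulrS addrA.
apply/startsP; first by lia.
split=> [t tm||].
- have tm' : (0 < t.+1 < m)%N by lia.
  rewrite dS; apply/boardP; rewrite (hole_spaced dD h0 tm'); move: dD.
  rewrite !inE => /or4P[] /eqP ->; rewrite /queen point_mulrn /=;
  split=> //; nia.
- by rewrite addrK; apply/boardP => -[_ _]; rewrite h0.
- by rewrite dS prednK; [apply/boardP => -[_ _]; rewrite hm|lia].
Qed.

Lemma card_board_starts m d : d \in directions ->
  ((m - 20) * m ^ 2 <= #|` starts d m.-1 (board m)|)%N.
Proof.
move=> dD.
pose S : seq (nat * (nat * nat)) := [seq (x, u) | x <- [seq x <- iota 0 m | queen_col m x],
  u <- [seq (i, j) | i <- iota 1 m, j <- iota 1 m]].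
pose g (u : nat * (nat * nat)) := queen m u.1 u.2.1 u.2.2 + d.
have SP u : u \in S -> [/\ queen_col m u.1, (0 < u.2.1 <= m)%N & (0 < u.2.2 <= m)%N].
  case/allpairsP => -[x _] /= [+ /allpairsP[[i j] /= [+ + ->]] ->] /=.
  by rewrite mem_filter !mem_iota add1n !ltnS => /andP[].
apply: (@leq_trans (size (map g S))).
  rewrite size_map !size_allpairs !size_iota mulnn leq_mul2r.
  by rewrite queen_cols_size orbT.
apply: uniq_leq_size; last first.
  by move=> _ /mapP[u /SP[? ? ?] ->]; apply: board_starts.
rewrite map_inj_in_uniq ?allpairs_uniq ?filter_uniq ?iota_uniq //.
- by move=> [? ?] [? ?] _ _ [-> ->].
- by move=> [? ?] [? ?] _ _ [-> ->].
move=> [x [i j]] [y [i' j']] /SP/= [Dx _ _] /SP/= [Dy _ _] /addIr [E1 E2].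
have [xm ym] := (queen_col_lt Dx, queen_col_lt Dy).
have [] : i%:Z = i' by apply: (@dvdz_lt_eq m x y) => //; lia.
move=> ii; have xy : x = y by rewrite ii in E1; lia.
by rewrite ii xy in E2 *; congr (_, (_, _)); nia.
Qed.

Lemma a_board k : (a k.+1 (4 * ((k.+2 - 20) * k.+2 ^ 2)) <= ((k.+2 + 4) * k.+2) ^ 2)%N.
Proof.
apply: leq_trans (card_board k.+2).
apply: (aP _ (ltn0Sn k)).2; exists (board k.+2) => //; rewrite num_segmentsE //.
set N := (_ * _ ^ 2)%N; have -> : (4 * N = \sum_(d <- directions) N)%N.
  by rewrite big_const_seq iter_addn_0 mulnC.
by rewrite !big_seq; apply: leq_sum => d; apply: card_board_starts.
Qed.

(** * Bounds on [f] and the limit *)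

Lemma f_bounds (R : realType) (k : nat) : (0 < k)%N ->
  (forall n : nat, (0 < n)%N -> f R k <= (a k n)%:R / n%:R) /\ k%:R / 4 <= f R k.
Proof.
move=> k_gt0; pose u n : R := (a k n)%:R.
have cu : u n / n%:R @[n --> \oo] --> inf [set u n / n%:R | n in [set n | (0 < n)%N]].
  by apply: fekete => [n|m n]; rewrite /u // -natrD ler_nat aD.
rewrite /f (cvg_lim _ cu) //; split=> [n n_gt0|].
  by apply: ge_inf; [exists 0 => _ [i _ <-]; rewrite divr_ge0 | exists n].
apply: lb_le_inf; first by exists (u 1%N / 1); exists 1%N.
move=> _ [n /= n_gt0 <-].
rewrite ler_pdivlMr ?ltr0n // mulrAC ler_pdivrMr // -!natrM ler_nat.
by rewrite [leqRHS]mulnC; apply: realizable_ge => //; apply: (aP n k_gt0).1.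
Qed.

Theorem corollary2 (R : realType) :
  (fun k : nat => f R k / k%:R) @ \oo --> (1 / 4 : R).
Proof.
(* With [m = k + 1], [(m + 4)^2 / (4 (m - 20) k)] exceeds 1/4 by about [29 / (4 m)], so [30 / m] is
   ample for large [k]. *)
have ub : (fun k => 1 / 4 + 30 * harmonic k : R) @ \oo --> (1 / 4 : R).
  rewrite -[X in _ --> X]addr0 -[X in _ --> _ + X](mulr0 (30 : R)).
  by apply: cvgD; [exact: cvg_cst | apply: cvgM; [exact: cvg_cst|exact: cvg_harmonic]].
apply: squeeze_cvgr ub; last exact: (@cvg_cst R).
exists 40%N => // k /= k40; have k_gt0 : (0 < k)%N by apply: leq_ltn_trans k40.
have [le_f ge_f] := f_bounds R k_gt0.
have kR : 0 < k%:R :> R by rewrite ltr0n.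
rewrite ler_pdivlMr // mulrC mul1r ge_f /= ler_pdivrMr //.
case: k k40 k_gt0 kR le_f {ge_f} => // k k40 _ kR le_f.
set N := (4 * ((k.+2 - 20) * k.+2 ^ 2))%N; have N_gt0 : (0 < N)%N by rewrite /N !muln_gt0; lia.
apply: le_trans (le_f _ N_gt0) _; rewrite ler_pdivrMr ?ltr0n //.
apply: le_trans (_ : (((k.+2 + 4) * k.+2) ^ 2)%N%:R <= _).
  by rewrite ler_nat a_board.
have -> : N%:R = 4 * (k.+1%:R - 19) * (k.+1%:R + 1) ^+ 2 :> R.
  by rewrite /N 2!natrM natrX natrB -?[k.+2%:R]natr1; [ring | lia].
have -> : (((k.+2 + 4) * k.+2) ^ 2)%N%:R = ((k.+1%:R + 5) * (k.+1%:R + 1)) ^+ 2 :> R.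
  by rewrite natrX natrM natrD -[k.+2%:R]natr1; ring.
rewrite /harmonic /= -[k.+2%:R]natr1.
have : 40 <= k.+1%:R :> R by rewrite ler_nat.
move: (k.+1%:R : R) => K K40.
have -> : (4^-1 + 30 / (K + 1)) * K * (4 * (K - 19) * (K + 1) ^+ 2) =
    K * (K - 19) * (K + 1) * (K + 121) by field; lra.
(* The difference is [91 K^2 - 2334 K - 25], positive for [K >= 40]. *)
have : (K + 5) ^+ 2 * (K + 1) <= K * (K - 19) * (K + 121) by nra.
rewrite -(@ler_pM2r _ (K + 1)); last by lra.
suff -> : ((K + 5) * (K + 1)) ^+ 2 = (K + 5) ^+ 2 * (K + 1) * (K + 1) by lra.
by ring.
Qed.
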